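(* Let $\mathbf L$ be the free lattice category generated by a set of objects (letters), and let $G:\mathbf L\to\mathit{Rel}$ be the functor described in the context. If $f:A\to B$ is an arrow of $\mathbf L$ such that $G(f)$ is a bijection, then there is an arrow term $f':A\to B$ of $\mathbf{SC^k}$ such that $f=f'$ in $\mathbf L$.
   Context: A lattice category is a category with all finite nonempty products and coproducts. The free lattice category $\mathbf L$ generated by a set of letters has as objects the formulae built from letters by the binary connectives $\wedge$ and $\vee$; $\wedge$ is (chosen) binary product and $\vee$ (chosen) binary coproduct, and $\mathbf L$ is free with this structure. Its arrows are given by arrow terms built, by composition $\circ$ and the operations $\wedge,\vee$ on arrows, from identities $\mathbf 1_A$, diagonals $\hat w_A:A\to A\wedge A$, projections $\hat k^i_{A_1,A_2}:A_1\wedge A_2\to A_i$, codiagonals $\check w_A:A\vee A\to A$, injections $\check k^i_{A_1,A_2}:A_i\to A_1\vee A_2$ ($i\in\{1,2\}$), and the arrows $\hat b^{\to},\hat b^{\leftarrow},\hat c,\check b^{\to},\check b^{\leftarrow},\check c,c^k$ below, modulo the equations expressing that $\wedge$ is binary product with these projections and diagonals, that $\vee$ is binary coproduct with these injections and codiagonals, and the following defining equations. Arrow terms of $\mathbf{SC^k}$ are those built by composition and the operations $\wedge,\vee$ from $\mathbf 1_A$ and the components (for all formulae as indices) of $\hat b^{\to}_{A,B,C}:A\wedge(B\wedge C)\to(A\wedge B)\wedge C$, its inverse $\hat b^{\leftarrow}_{A,B,C}$, $\hat c_{A,B}:A\wedge B\to B\wedge A$, the analogous $\check b^{\to},\check b^{\leftarrow},\check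 c$ for $\vee$, and $c^k_{A,B,C,D}:(A\wedge B)\vee(C\wedge D)\to(A\vee C)\wedge(B\vee D)$. In $\mathbf L$ these are interpreted as the canonical associativity and commutativity isomorphisms of products (respectively coproducts), e.g. $\hat c_{A,B}=(\hat k^2_{A,B}\wedge\hat k^1_{A,B})\circ\hat w_{A\wedge B}$ and $\hat b^{\to}_{A,B,C}=((\mathbf 1_A\wedge\hat k^1_{B,C})\wedge(\hat k^2_{B,C}\circ\hat k^2_{A,B\wedge C}))\circ\hat w_{A\wedge(B\wedge C)}$, and $$c^k_{A,B,C,D}=((\hat k^1_{A,B}\vee\hat k^1_{C,D})\wedge(\hat k^2_{A,B}\vee\hat k^2_{C,D}))\circ\hat w_{(A\wedge B)\vee(C\wedge D)},$$ which is equal to $\check w_{(A\vee C)\wedge(B\vee D)}\circ((\check k^1_{A,C}\wedge\check k^1_{B,D})\vee(\check k^2_{A,C}\wedge\check k^2_{B,D}))$. $\mathit{Rel}$ is the category whose objects are finite ordinals and whose arrows are relations between them. The functor $G$ sends a formula $A$ to the number of occurrences of letters in $A$ (the occurrences being numbered from left to right). On arrows: $G(\mathbf 1_A)$ is the identity relation; $G(\hat w_A)$ relates each letter occurrence in $A$ to the two corresponding occurrences in $A\wedge A$; $G(\hat k^i_{A_1,A_2})$ relates each letter occurrence in the conjunct $A_i$ of $A_1\wedge A_2$ to the corresponding occurrence in $A_i$ (and nothing else); $G(\check w_A)$ and $G(\check k^i_{A_1,A_2})$ are the converses of the corresponding relations for $\hat w_A$ and $\hat k^i_{A_1,A_2}$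 (with $\vee$ in place of $\wedge$); $G(g\circ f)$ is the composite relation; and $G(f\wedge g)$, $G(f\vee g)$ are the side-by-side (disjoint) sum of $G(f)$ and $G(g)$. *)

(* Defs.v *)
From mathcomp Require Import all_boot.

Set Implicit Arguments.
Unset Strict Implicit.
Unset Printing Implicit Defensive.

Inductive formula (X : Type) : Type :=
| Letter of X
| And of formula X & formula X
| Or of formula X & formula X.

Declare Scope lat_scope.
Delimit Scope lat_scope with L.
Bind Scope lat_scope with formula.
Open Scope lat_scope.

Notation "A '/.\' B" := (And A B)
  (at level 40, left associativity) : lat_scope.
Notation "A '\./' B" := (Or A B)
  (at level 40, left associativity) : lat_scope.

(* Arrow terms of the free lattice category.  The prefix [h] stands for a hat
   (structure of the product), [v] for a check (structure of the coproduct). *)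
Inductive term (X : Type) : formula X -> formula X -> Type :=
| Id A : term A A
| Comp A B C : term B C -> term A B -> term A C
| AndT A1 A2 B1 B2 :
    term A1 B1 -> term A2 B2 -> term (A1 /.\ A2) (B1 /.\ B2)
| OrT A1 A2 B1 B2 :
    term A1 B1 -> term A2 B2 -> term (A1 \./ A2) (B1 \./ B2)
| hw A : term A (A /.\ A)
| hk1 A1 A2 : term (A1 /.\ A2) A1
| hk2 A1 A2 : term (A1 /.\ A2) A2
| vw A : term (A \./ A) A
| vk1 A1 A2 : term A1 (A1 \./ A2)
| vk2 A1 A2 : term A2 (A1 \./ A2)
| hbr A B C : term (A /.\ (B /.\ C)) ((A /.\ B) /.\ C)
| hbl A B C : term ((A /.\ B) /.\ C) (A /.\ (B /.\ C))
| hc A B : term (A /.\ B) (B /.\ A)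
| vbr A B C : term (A \./ (B \./ C)) ((A \./ B) \./ C)
| vbl A B C : term ((A \./ B) \./ C) (A \./ (B \./ C))
| vc A B : term (A \./ B) (B \./ A)
| ck A B C D :
    term ((A /.\ B) \./ (C /.\ D)) ((A \./ C) /.\ (B \./ D)).

Arguments Id {X} A.
Arguments hw {X} A.
Arguments hk1 {X} A1 A2.
Arguments hk2 {X} A1 A2.
Arguments vw {X} A.
Arguments vk1 {X} A1 A2.
Arguments vk2 {X} A1 A2.
Arguments hbr {X} A B C.
Arguments hbl {X} A B C.
Arguments hc {X} A B.
Arguments vbr {X} A B C.
Arguments vbl {X} A B C.
Arguments vc {X} A B.
Arguments ck {X} A B C D.

Declare Scope latT_scope.
Delimit Scope latT_scope with T.
Bind Scope latT_scope with term.

Notation "g \o f" := (Comp g f) : latT_scope.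
Notation "f '/.\' g" := (AndT f g) : latT_scope.
Notation "f '\./' g" := (OrT f g) : latT_scope.

Reserved Notation "f '=L' g" (at level 70, no associativity).

(* Equality of arrows in the free lattice category: an arrow is an arrow term
   modulo this congruence. *)
Inductive eqL (X : Type) :
    forall A B : formula X, term A B -> term A B -> Prop :=
| eqL_refl A B (f : term A B) : f =L f
| eqL_sym A B (f g : term A B) : f =L g -> g =L f
| eqL_trans A B (f g h : term A B) : f =L g -> g =L h -> f =L h
| eqL_Comp A B C (g g' : term B C) (f f' : term A B) :
    g =L g' -> f =L f' -> g \o f =L g' \o f'
| eqL_And A1 A2 B1 B2 (f f' : term A1 B1) (g g' : term A2 B2) :
    f =L f' -> g =L g' -> f /.\ g =L f' /.\ g'
| eqL_Or A1 A2 B1 B2 (f f' : term A1 B1) (g g' : term A2 B2) :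
    f =L f' -> g =L g' -> f \./ g =L f' \./ g'
| eqL_idl A B (f : term A B) : Id B \o f =L f
| eqL_idr A B (f : term A B) : f \o Id A =L f
| eqL_assoc A B C D (h : term C D) (g : term B C) (f : term A B) :
    h \o (g \o f) =L h \o g \o f
| eqL_And1 A B : Id A /.\ Id B =L Id (A /.\ B)
| eqL_And2 A1 A2 B1 B2 C1 C2 (g1 : term B1 C1) (f1 : term A1 B1)
    (g2 : term B2 C2) (f2 : term A2 B2) :
    (g1 \o f1) /.\ (g2 \o f2) =L (g1 /.\ g2) \o (f1 /.\ f2)
| eqL_hw_nat A B (f : term A B) : (f /.\ f) \o hw A =L hw B \o f
| eqL_hk1_nat A1 A2 B1 B2 (f1 : term A1 B1) (f2 : term A2 B2) :
    hk1 B1 B2 \o (f1 /.\ f2) =L f1 \o hk1 A1 A2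
| eqL_hk2_nat A1 A2 B1 B2 (f1 : term A1 B1) (f2 : term A2 B2) :
    hk2 B1 B2 \o (f1 /.\ f2) =L f2 \o hk2 A1 A2
| eqL_hk1w A : hk1 A A \o hw A =L Id A
| eqL_hk2w A : hk2 A A \o hw A =L Id A
| eqL_hkkw A B : (hk1 A B /.\ hk2 A B) \o hw (A /.\ B) =L Id (A /.\ B)
| eqL_Or1 A B : Id A \./ Id B =L Id (A \./ B)
| eqL_Or2 A1 A2 B1 B2 C1 C2 (g1 : term B1 C1) (f1 : term A1 B1)
    (g2 : term B2 C2) (f2 : term A2 B2) :
    (g1 \o f1) \./ (g2 \o f2) =L (g1 \./ g2) \o (f1 \./ f2)
| eqL_vw_nat A B (f : term A B) : vw B \o (f \./ f) =L f \o vw A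
| eqL_vk1_nat A1 A2 B1 B2 (f1 : term A1 B1) (f2 : term A2 B2) :
    (f1 \./ f2) \o vk1 A1 A2 =L vk1 B1 B2 \o f1
| eqL_vk2_nat A1 A2 B1 B2 (f1 : term A1 B1) (f2 : term A2 B2) :
    (f1 \./ f2) \o vk2 A1 A2 =L vk2 B1 B2 \o f2
| eqL_vwk1 A : vw A \o vk1 A A =L Id A
| eqL_vwk2 A : vw A \o vk2 A A =L Id A
| eqL_vwkk A B : vw (A \./ B) \o (vk1 A B \./ vk2 A B) =L Id (A \./ B)
| eqL_hbr A B C :
    hbr A B C =L ((Id A /.\ hk1 B C) /.\ (hk2 B C \o hk2 A (B /.\ C)))
                   \o hw (A /.\ (B /.\ C))
| eqL_hbl A B C :
    hbl A B C =L ((hk1 A B \o hk1 (A /.\ B) C) /.\ (hk2 A B /.\ Id C))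
                   \o hw ((A /.\ B) /.\ C)
| eqL_hc A B : hc A B =L (hk2 A B /.\ hk1 A B) \o hw (A /.\ B)
| eqL_vbr A B C :
    vbr A B C =L vw ((A \./ B) \./ C)
                   \o ((vk1 (A \./ B) C \o vk1 A B) \./ (vk2 A B \./ Id C))
| eqL_vbl A B C :
    vbl A B C =L vw (A \./ (B \./ C))
                   \o ((Id A \./ vk1 B C) \./ (vk2 A (B \./ C) \o vk2 B C))
| eqL_vc A B : vc A B =L vw (B \./ A) \o (vk2 B A \./ vk1 B A)
| eqL_ck A B C D :
    ck A B C D =L ((hk1 A B \./ hk1 C D) /.\ (hk2 A B \./ hk2 C D))
                    \o hw ((A /.\ B) \./ (C /.\ D))
where "f '=L' g" := (eqL f%T g%T).

Inductive is_SCk (X : Type) : forall A B : formula X, term A B -> Prop :=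
| SCk_Id A : is_SCk (Id A)
| SCk_Comp A B C (g : term B C) (f : term A B) :
    is_SCk g -> is_SCk f -> is_SCk (g \o f)
| SCk_And A1 A2 B1 B2 (f : term A1 B1) (g : term A2 B2) :
    is_SCk f -> is_SCk g -> is_SCk (f /.\ g)
| SCk_Or A1 A2 B1 B2 (f : term A1 B1) (g : term A2 B2) :
    is_SCk f -> is_SCk g -> is_SCk (f \./ g)
| SCk_hbr A B C : is_SCk (hbr A B C)
| SCk_hbl A B C : is_SCk (hbl A B C)
| SCk_hc A B : is_SCk (hc A B)
| SCk_vbr A B C : is_SCk (vbr A B C)
| SCk_vbl A B C : is_SCk (vbl A B C)
| SCk_vc A B : is_SCk (vc A B)
| SCk_ck A B C D : is_SCk (ck A B C D).

(* Arrows m -> n of Rel; two of them are equal when they are so pointwise. *)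
Definition finrel (m n : nat) := 'I_m -> 'I_n -> bool.

Definition rid n : finrel n n := fun i j => i == j.

Definition rcomp m n p (S : finrel n p) (R : finrel m n) : finrel m p :=
  fun i k => [exists j, R i j && S j k].

Definition rconv m n (R : finrel m n) : finrel n m := fun j i => R i j.

Definition rsum m1 m2 n1 n2 (R : finrel m1 n1) (S : finrel m2 n2) :
    finrel (m1 + m2) (n1 + n2) :=
  fun i j => match split i, split j with
             | inl i1, inl j1 => R i1 j1
             | inr i2, inr j2 => S i2 j2
             | _, _ => false
             end.

Definition rdiag n : finrel n (n + n) :=
  fun i j => (j == lshift n i) || (j == rshift n i).

Definition rproj1 m n : finrel (m + n) m := fun i j => i == lshift n j.

Definition rproj2 m n : finrel (m + n) n := fun i j => i == rshift m j.

Arguments rid n : clear implicits.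
Arguments rdiag n : clear implicits.
Arguments rproj1 m n : clear implicits.
Arguments rproj2 m n : clear implicits.

Fixpoint G0 (X : Type) (A : formula X) : nat :=
  match A with
  | Letter _ => 1
  | And A1 A2 | Or A1 A2 => G0 A1 + G0 A2
  end.

(* The values at hbr, ..., ck are those forced by the defining equations. *)
Fixpoint G (X : Type) (A B : formula X) (f : term A B) : finrel (G0 A) (G0 B) :=
  match f in term A B return finrel (G0 A) (G0 B) with
  | Id A => rid (G0 A)
  | Comp _ _ _ g f => rcomp (G g) (G f)
  | AndT _ _ _ _ f g => rsum (G f) (G g)
  | OrT _ _ _ _ f g => rsum (G f) (G g)
  | hw A => rdiag (G0 A)
  | hk1 A1 A2 => rproj1 (G0 A1) (G0 A2)
  | hk2 A1 A2 => rproj2 (G0 A1) (G0 A2)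
  | vw A => rconv (rdiag (G0 A))
  | vk1 A1 A2 => rconv (rproj1 (G0 A1) (G0 A2))
  | vk2 A1 A2 => rconv (rproj2 (G0 A1) (G0 A2))
  | hbr A B C =>
      let a := G0 A in let b := G0 B in let c := G0 C in
      rcomp (rsum (rsum (rid a) (rproj1 b c))
                  (rcomp (rproj2 b c) (rproj2 a (b + c))))
            (rdiag (a + (b + c)))
  | hbl A B C =>
      let a := G0 A in let b := G0 B in let c := G0 C in
      rcomp (rsum (rcomp (rproj1 a b) (rproj1 (a + b) c))
                  (rsum (rproj2 a b) (rid c)))
            (rdiag ((a + b) + c))
  | hc A B =>
      let a := G0 A in let b := G0 B in
      rcomp (rsum (rproj2 a b) (rproj1 a b)) (rdiag (a + b))
  | vbr A B C =>
      let a := G0 A in let b := G0 B in let c := G0 C in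
      rcomp (rconv (rdiag ((a + b) + c)))
            (rsum (rcomp (rconv (rproj1 (a + b) c)) (rconv (rproj1 a b)))
                  (rsum (rconv (rproj2 a b)) (rid c)))
  | vbl A B C =>
      let a := G0 A in let b := G0 B in let c := G0 C in
      rcomp (rconv (rdiag (a + (b + c))))
            (rsum (rsum (rid a) (rconv (rproj1 b c)))
                  (rcomp (rconv (rproj2 a (b + c))) (rconv (rproj2 b c))))
  | vc A B =>
      let a := G0 A in let b := G0 B in
      rcomp (rconv (rdiag (b + a)))
            (rsum (rconv (rproj2 b a)) (rconv (rproj1 b a)))
  | ck A B C D =>
      let a := G0 A in let b := G0 B in let c := G0 C in let d := G0 D in
      rcomp (rsum (rsum (rproj1 a b) (rproj1 c d))
                  (rsum (rproj2 a b) (rproj2 c d)))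
            (rdiag ((a + b) + (c + d)))
  end.

Definition is_bijection m n (R : finrel m n) : Prop :=
  exists2 h : 'I_m -> 'I_n, bijective h & forall i j, R i j = (j == h i).

Lemma split_lshift m n (i : 'I_m) : split (lshift n i) = inl i.
Proof. exact: (unsplitK (inl i)). Qed.

Lemma split_rshift m n (i : 'I_n) : split (rshift m i) = inr i.
Proof. exact: (unsplitK (inr i)). Qed.

Lemma exists_split m n (P : pred 'I_(m + n)) :
  [exists j, P j] = [exists j, P (lshift n j)] || [exists j, P (rshift m j)].
Proof.
apply/existsP/orP => [[j]|[]/existsP[j Pj]]; try by eexists; exact: Pj.
by case: (split_ordP j) => k -> Pk; [left | right]; apply/existsP; exists k.
Qed.

Lemma exists_eql n (x : 'I_n) (P : pred 'I_n) :
  [exists j, (j == x) && P j] = P x.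
Proof.
by apply/existsP/idP => [[j /andP[/eqP->]]//|Px]; exists x; rewrite eqxx.
Qed.

Lemma exists_eqr n (x : 'I_n) (P : pred 'I_n) :
  [exists j, P j && (j == x)] = P x.
Proof.
rewrite -[RHS]exists_eql; by apply: eq_existsb => j; rewrite andbC.
Qed.

Lemma exists_eql_sym n (x : 'I_n) (P : pred 'I_n) :
  [exists j, (x == j) && P j] = P x.
Proof.
rewrite -[RHS]exists_eql; by apply: eq_existsb => j; rewrite eq_sym.
Qed.

Lemma exists_eqr_sym n (x : 'I_n) (P : pred 'I_n) :
  [exists j, P j && (x == j)] = P x.
Proof.
rewrite -[RHS]exists_eqr; by apply: eq_existsb => j; rewrite [x == j]eq_sym.
Qed.

Lemma exists_false n : [exists j : 'I_n, false] = false.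
Proof. by apply/existsP => -[]. Qed.

Local Ltac shift_simpl :=
  rewrite /= ?split_lshift ?split_rshift
          /= ?eq_lshift ?eq_rshift ?eq_lrshift ?eq_rlshift /= ?andbF ?orbF.

Local Ltac exists_norm :=
  repeat match goal with
  | |- (_ || _) = _ => apply: f_equal2
  | |- [exists j, _] = _ => apply: eq_existsb => ?; shift_simpl; reflexivity
  end; try reflexivity.

Local Ltac rel_eq :=
  rewrite ?exists_split;
  (etransitivity;
   [exists_norm | apply: esym; etransitivity; [exists_norm | apply: esym]]);
  rewrite ?exists_false ?orbF /=;
  rewrite ?exists_eql ?exists_eqr ?exists_eql_sym ?exists_eqr_sym ?orbF ?orFb;
  try done; try by rewrite eq_sym.

(* [G] is well defined on the arrows of the free lattice category. *)
Lemma G_eqL (X : Type) (A B : formula X) (f g : term A B) :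
  f =L g -> G f =2 G g.
Proof.
elim=> {A B f g}.
- by [].
- by move=> ? ? f g _ IH i j; rewrite IH.
- by move=> ? ? f g h _ IH _ IH' i j; rewrite IH.
- move=> ? ? ? g g' f f' _ IH _ IH' i j /=.
  by apply: eq_existsb => k; rewrite IH IH'.
- move=> ? ? ? ? f f' g g' _ IH _ IH' i j /=; rewrite /rsum.
  by case: split => ?; case: split => ?; rewrite ?IH ?IH'.
- move=> ? ? ? ? f f' g g' _ IH _ IH' i j /=; rewrite /rsum.
  by case: split => ?; case: split => ?; rewrite ?IH ?IH'.
- by move=> ? ? f i j; rewrite /= /rcomp /rid exists_eqr.
- by move=> ? ? f i j; rewrite /= /rcomp /rid exists_eql_sym.
- move=> ? ? ? ? h g f i j; rewrite /= /rcomp.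
  apply/existsP/existsP => -[k /andP[]].
    move=> /existsP[l /andP[fl gk]] hj; exists l; rewrite fl.
    by apply/existsP; exists k; rewrite gk.
  move=> fk /existsP[l /andP[gl hj]]; exists l; rewrite hj andbT.
  by apply/existsP; exists k; rewrite fk.
all: move=> * i j; rewrite /= /rcomp /rsum /rdiag /rproj1 /rproj2 /rconv /rid.
all: try reflexivity.
all: repeat match goal with |- context [@G _ _ _ ?f] => move: (G f) => ? end.
all: simpl G0 in *.
all: repeat match goal with i : 'I_(_ + _) |- _ =>
       let k := fresh "k" in destruct (split_ordP i) as [k ->|k ->]; clear i
     end.
all: rewrite ?split_lshift ?split_rshift.
all: try (solve [shift_simpl; done]).
all: try rel_eq.
all: by shift_simpl.
Qed.

(* Main.v *)
Require Import Defs.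
From mathcomp Require Import all_boot.
From Stdlib Require Import Setoid Morphisms.

(** Every arrow of [L] is equal to a cut-free one, built from identities of
    letters by pairing, copairing, precomposition with projections and
    postcomposition with injections.  By induction on a cut-free [f : A -> B]
    whose relation [G f] is a partial injection, [f = q \o s \o p] where [s] is
    in SC^k, [p] only discards conjuncts and [q] only adds disjuncts.  The step
    for a pair [<f, g>] rests on the fact that two discarding arrows [p], [q]
    out of the same formula which keep disjoint sets of occurrences satisfy
    [<p, q> = s \o r] with [r] discarding and [s] in SC^k; when the source is a
    disjunction, this is exactly what intermutation [ck] provides.  When [G f]
    is a bijection, [p] discards nothing and [q] adds nothing, so that both are
    in SC^k. *)

Set Implicit Arguments.
Unset Strict Implicit.
Unset Printing Implicit Defensive.

#[local] Hint Resolve eqL_refl : core.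

(** * Rewriting modulo equality of arrows *)

#[export] Instance eqL_equiv X (A B : formula X) : Equivalence (@eqL X A B).
Proof. split; [exact: eqL_refl | exact: eqL_sym | exact: eqL_trans]. Qed.

#[export] Instance Comp_proper X (A B C : formula X) :
  Proper (@eqL X B C ==> @eqL X A B ==> @eqL X A C) (@Comp X A B C).
Proof. by move=> g g' Eg f f' Ef; apply: eqL_Comp. Qed.

#[export] Instance AndT_proper X (A1 A2 B1 B2 : formula X) :
  Proper (@eqL X A1 B1 ==> @eqL X A2 B2 ==> @eqL X _ _) (@AndT X A1 A2 B1 B2).
Proof. by move=> g g' Eg f f' Ef; apply: eqL_And. Qed.

#[export] Instance OrT_proper X (A1 A2 B1 B2 : formula X) :
  Proper (@eqL X A1 B1 ==> @eqL X A2 B2 ==> @eqL X _ _) (@OrT X A1 A2 B1 B2).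
Proof. by move=> g g' Eg f f' Ef; apply: eqL_Or. Qed.

(** * Products and coproducts up to duality *)

Section Polarity.
Variable X : Type.
Implicit Types (A B C D : formula X) (b c : bool).

(* Duality is treated by a polarity [b]: [hom true] is [L] with product [And],
   [hom false] is the opposite category of [L], whose product is [Or]. *)
Definition op b A B := if b then A /.\ B else A \./ B.

Definition hom b A B : Type := if b then term A B else term B A.

Definition hid b A : hom b A A := if b return hom b A A then Id A else Id A.

Definition hcomp b A B C : hom b B C -> hom b A B -> hom b A C :=
  if b return hom b B C -> hom b A B -> hom b A C
  then fun g f => Comp g f else fun g f => Comp f g.

Definition heq b A B : hom b A B -> hom b A B -> Prop :=
  if b return hom b A B -> hom b A B -> Prop then @eqL X A B else @eqL X B A.

Definition pr1 b A B : hom b (op b A B) A :=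
  if b return hom b (op b A B) A then hk1 A B else vk1 A B.

Definition pr2 b A B : hom b (op b A B) B :=
  if b return hom b (op b A B) B then hk2 A B else vk2 A B.

Definition pairing b A B C : hom b C A -> hom b C B -> hom b C (op b A B) :=
  if b return hom b C A -> hom b C B -> hom b C (op b A B)
  then fun f g => Comp (AndT f g) (hw C) else fun f g => Comp (vw C) (OrT f g).

(** The connective [c] is independent of the polarity [b], because discarding takes place below both
    connectives. *)
Definition par b c A1 A2 B1 B2 :
    hom b A1 B1 -> hom b A2 B2 -> hom b (op c A1 A2) (op c B1 B2) :=
  match b, c return
    hom b A1 B1 -> hom b A2 B2 -> hom b (op c A1 A2) (op c B1 B2) with
  | true, true | false, true => fun f g => AndT f g
  | true, false | false, false => fun f g => OrT f g
  end.

Definition hSCk b A B : hom b A B -> Prop :=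
  if b return hom b A B -> Prop then @is_SCk X A B else @is_SCk X B A.

(* Equal in [L] to an arrow term of SC^k. *)
Definition esc b A B (f : hom b A B) := exists2 g, hSCk g & heq f g.

Local Notation "g ** f" := (hcomp g f) (at level 41, right associativity).
Local Notation "f =h g" := (heq f g) (at level 70).

#[local] Instance heq_equiv b A B : Equivalence (@heq b A B).
Proof. by case: b; apply: eqL_equiv. Qed.

Lemma heq_refl b A B (f : hom b A B) : f =h f.
Proof. reflexivity. Qed.
#[local] Hint Resolve heq_refl : core.

#[local] Instance hcomp_proper b A B C :
  Proper (@heq b B C ==> @heq b A B ==> @heq b A C) (@hcomp b A B C).
Proof. by case: b => g g' Eg f f' Ef; apply: eqL_Comp. Qed.

#[local] Instance pairing_proper b A B C :
  Proper (@heq b C A ==> @heq b C B ==> @heq b C _) (@pairing b A B C).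
Proof.
by case: b => g g' Eg f f' Ef; apply: eqL_Comp; try reflexivity;
  [apply: eqL_And | apply: eqL_Or].
Qed.

#[local] Instance par_proper b c A1 A2 B1 B2 :
  Proper (@heq b A1 B1 ==> @heq b A2 B2 ==> @heq b _ _) (@par b c A1 A2 B1 B2).
Proof.
by case: b c => [] [] g g' Eg f f' Ef; (apply: eqL_And || apply: eqL_Or).
Qed.

Lemma hcompA b A B C D (h : hom b C D) (g : hom b B C) (f : hom b A B) :
  (h ** g) ** f =h h ** g ** f.
Proof. by case: b h g f => h g f /=; [symmetry|]; apply: eqL_assoc. Qed.

Lemma hcomp1l b A B (f : hom b A B) : hid b B ** f =h f.
Proof. by case: b f => f; [apply: eqL_idl | apply: eqL_idr]. Qed.

Lemma hcomp1r b A B (f : hom b A B) : f ** hid b A =h f.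
Proof. by case: b f => f; [apply: eqL_idr | apply: eqL_idl]. Qed.

Lemma pr1_pairing b A B C (f : hom b C A) (g : hom b C B) :
  pr1 b A B ** pairing f g =h f.
Proof.
case: b f g => f g /=.
  by rewrite eqL_assoc eqL_hk1_nat -eqL_assoc eqL_hk1w eqL_idr.
by rewrite -eqL_assoc eqL_vk1_nat eqL_assoc eqL_vwk1 eqL_idl.
Qed.

Lemma pr2_pairing b A B C (f : hom b C A) (g : hom b C B) :
  pr2 b A B ** pairing f g =h g.
Proof.
case: b f g => f g /=.
  by rewrite eqL_assoc eqL_hk2_nat -eqL_assoc eqL_hk2w eqL_idr.
by rewrite -eqL_assoc eqL_vk2_nat eqL_assoc eqL_vwk2 eqL_idl.
Qed.

Lemma pairing_comp b A B C D (f : hom b C A) (g : hom b C B) (h : hom b D C) :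
  pairing f g ** h =h pairing (f ** h) (g ** h).
Proof.
case: b f g h => f g h /=.
  by rewrite eqL_And2 -!eqL_assoc eqL_hw_nat.
by rewrite eqL_Or2 !eqL_assoc eqL_vw_nat.
Qed.

Lemma pairing_pr b A B : pairing (pr1 b A B) (pr2 b A B) =h hid b (op b A B).
Proof. by case: b; [apply: eqL_hkkw | apply: eqL_vwkk]. Qed.

Lemma pairing_eta b A B C (f : hom b C (op b A B)) :
  f =h pairing (pr1 b A B ** f) (pr2 b A B ** f).
Proof. by rewrite -pairing_comp pairing_pr hcomp1l. Qed.

Lemma par_comp b c A1 A2 B1 B2 C1 C2 (g1 : hom b B1 C1) (f1 : hom b A1 B1)
    (g2 : hom b B2 C2) (f2 : hom b A2 B2) :
  par c (g1 ** f1) (g2 ** f2) =h par c g1 g2 ** par c f1 f2.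
Proof.
by case: b c g1 f1 g2 f2 => [] [] g1 f1 g2 f2 /=;
  (apply: eqL_And2 || apply: eqL_Or2).
Qed.

Lemma par_pairing b A1 A2 B1 B2 (f : hom b A1 B1) (g : hom b A2 B2) :
  par b f g =h pairing (f ** pr1 b A1 A2) (g ** pr2 b A1 A2).
Proof.
transitivity (pairing (pr1 b B1 B2 ** par b f g) (pr2 b B1 B2 ** par b f g)).
  exact: pairing_eta.
case: b f g => f g /=.
  by rewrite eqL_hk1_nat eqL_hk2_nat.
by rewrite eqL_vk1_nat eqL_vk2_nat.
Qed.

(** Intermutation is self-dual. Project the copairing onto each conjunct: naturality moves the
    projections past the codiagonal and the injections, and the copairing of the two injections is
    an identity. *)
Lemma ck_copairing A B C D :
  (ck A B C D =L vw _ \o ((vk1 A C /.\ vk1 B D) \./ (vk2 A C /.\ vk2 B D)))%L.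
Proof.
transitivity (pairing (b := true) (OrT (hk1 A B) (hk1 C D))
                      (OrT (hk2 A B) (hk2 C D))).
  exact: eqL_ck.
symmetry; etransitivity; first exact: (pairing_eta (b := true)).
rewrite /= !eqL_assoc -!eqL_vw_nat -!eqL_assoc -!eqL_Or2.
by rewrite !eqL_hk1_nat !eqL_hk2_nat !eqL_Or2 !eqL_assoc !eqL_vwkk !eqL_idl.
Qed.

(** * Closure properties of the arrows equal to terms of SC^k *)

Lemma esc_heq b A B (f g : hom b A B) : f =h g -> esc f -> esc g.
Proof. by move=> fg [h Sh fh]; exists h => //; rewrite -fg. Qed.

Lemma esc_id b A : esc (hid b A).
Proof. by exists (hid b A) => //; case: b; apply: SCk_Id. Qed.

Lemma esc_comp b A B C (g : hom b B C) (f : hom b A B) :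
  esc g -> esc f -> esc (g ** f).
Proof.
move=> [g' Sg gg'] [f' Sf ff']; exists (g' ** f'); last by rewrite gg' ff'.
by case: b g f g' f' Sg Sf {gg' ff'} => g f g' f' Sg Sf; apply: SCk_Comp.
Qed.

Lemma esc_par b c A1 A2 B1 B2 (f : hom b A1 B1) (g : hom b A2 B2) :
  esc f -> esc g -> esc (par c f g).
Proof.
move=> [f' Sf ff'] [g' Sg gg']; exists (par c f' g'); last by rewrite gg' ff'.
by case: b c g f g' f' Sg Sf {gg' ff'} => [] [] g f g' f' Sg Sf /=;
  (apply: SCk_And || apply: SCk_Or).
Qed.

Lemma esc_swap b A B : esc (pairing (pr2 b A B) (pr1 b A B)).
Proof.
case: b; [exists (hc A B) | exists (vc B A)]; try by constructor.
  by symmetry; apply: eqL_hc.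
by symmetry; apply: eqL_vc.
Qed.

(** Iterated pairings of projections are the form in which later coherence equations are checked;
    the defining equations of [hbr] and [vbl] have a [par] inside instead. *)
Lemma esc_assocr b A B C :
  esc (pairing (pairing (pr1 b A (op b B C)) (pr1 b B C ** pr2 b A (op b B C)))
               (pr2 b B C ** pr2 b A (op b B C))).
Proof.
have E : pairing (pairing (pr1 b A (op b B C))
                          (pr1 b B C ** pr2 b A (op b B C)))
                 (pr2 b B C ** pr2 b A (op b B C))
      =h pairing (par b (hid b A) (pr1 b B C))
                 (pr2 b B C ** pr2 b A (op b B C)).
  by rewrite par_pairing hcomp1l.
apply: (esc_heq (symmetry E)) => {E}.
case: b; [exists (hbr A B C) | exists (vbl A B C)]; try by constructor.
  by symmetry; apply: eqL_hbr.
by symmetry; apply: eqL_vbl.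
Qed.

Lemma esc_assocl b A B C :
  esc (pairing (pr1 b A B ** pr1 b (op b A B) C)
               (pairing (pr2 b A B ** pr1 b (op b A B) C)
                        (pr2 b (op b A B) C))).
Proof.
have E : pairing (pr1 b A B ** pr1 b (op b A B) C)
               (pairing (pr2 b A B ** pr1 b (op b A B) C) (pr2 b (op b A B) C))
      =h pairing (pr1 b A B ** pr1 b (op b A B) C)
                 (par b (pr2 b A B) (hid b C)).
  by rewrite par_pairing hcomp1l.
apply: (esc_heq (symmetry E)) => {E}.
case: b; [exists (hbl A B C) | exists (vbr A B C)]; try by constructor.
  by symmetry; apply: eqL_hbl.
by symmetry; apply: eqL_vbr.
Qed.

(** At either polarity this is [ck]: by its defining equation when [b] is [true], and by
    [ck_copairing], with the two middle indices exchanged, when [b] is [false]. *)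
Lemma esc_medial b A B C D :
  esc (pairing (par (~~ b) (pr1 b A B) (pr1 b C D))
               (par (~~ b) (pr2 b A B) (pr2 b C D))).
Proof.
case: b; [exists (ck A B C D) | exists (ck A C B D)]; try by constructor.
  by symmetry; apply: eqL_ck.
by symmetry; apply: ck_copairing.
Qed.

(** Brings both sides of a coherence equation to iterated pairings of composites with
    projections. *)
Ltac hnorm := rewrite ?par_pairing; repeat progress rewrite
  ?pairing_comp ?hcompA ?pr1_pairing ?pr2_pairing ?hcomp1l ?hcomp1r.

Lemma esc_swap3 b A B C :
  esc (pairing (pr1 b B C ** pr2 b A (op b B C))
     (pairing (pr1 b A (op b B C)) (pr2 b B C ** pr2 b A (op b B C)))).
Proof.
apply: (esc_heq _ (esc_comp (esc_assocl b B A C)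
  (esc_comp (esc_par b (esc_swap b A B) (esc_id b C)) (esc_assocr b A B C)))).
by hnorm.
Qed.

(** The analogue of [esc_medial] with a single connective, obtained from associativity and
    commutativity alone. *)
Lemma esc_mid b A B C D :
  esc (pairing (par b (pr1 b A B) (pr1 b C D)) (par b (pr2 b A B) (pr2 b C D))).
Proof.
apply: (esc_heq _ (esc_comp (esc_assocr b A C (op b B D))
  (esc_comp (esc_par b (esc_id b A) (esc_swap3 b B C D))
            (esc_assocl b A B (op b C D))))).
by hnorm.
Qed.

(** The connectives are named relative to [b], so that one induction serves both polarities. *)
Lemma op_ind b (P : formula X -> Prop) :
    (forall p, P (Letter p)) ->
    (forall A1 A2, P A1 -> P A2 -> P (op b A1 A2)) ->
    (forall A1 A2, P A1 -> P A2 -> P (op (~~ b) A1 A2)) ->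
  forall A, P A.
Proof.
by case: b => PL P1 P2; elim=> *; (exact: PL || (apply: P1 || apply: P2)).
Qed.

(** * Discarding arrows *)

(** [proj_par] allows discarding at any depth below either connective. Up to equality, it also
    builds the identities of compound formulae from those of letters. *)
Inductive is_proj b : forall A A', hom b A A' -> Prop :=
| proj_letter p : is_proj (hid b (Letter p))
| proj_pr1 A1 A2 A' (f : hom b A1 A') :
    is_proj f -> is_proj (f ** pr1 b A1 A2)
| proj_pr2 A1 A2 A' (f : hom b A2 A') :
    is_proj f -> is_proj (f ** pr2 b A1 A2)
| proj_par c A1 A2 A1' A2' (f : hom b A1 A1') (g : hom b A2 A2') :
    is_proj f -> is_proj g -> is_proj (par c f g).

(** Inversion in impredicative form: the target formula is an index of [hom], and quantifying over
    [P] avoids equations between dependently typed arrows. [op_cases] and [dop_cases] follow the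
    same pattern. *)
Definition letter_cases b p A' (f : hom b (Letter p) A') :=
  forall P : forall A', hom b (Letter p) A' -> Prop,
  P _ (hid b (Letter p)) -> P A' f.

Lemma proj_letter_inv b p A' (f : hom b (Letter p) A') :
  is_proj f -> letter_cases f.
Proof.
move=> Pf.
pose Q A A' : hom b A A' -> Prop :=
  if A is Letter q then @letter_cases b q A' else fun=> True.
suff: Q _ _ f by [].
by case: Pf => [q P //|A1 A2|A1 A2|[]//]; rewrite /Q; case: b {f Q}.
Qed.

Definition op_cases b A1 A2 A' (f : hom b (op b A1 A2) A') :=
  forall P : forall A', hom b (op b A1 A2) A' -> Prop,
  (forall A' (f : hom b A1 A'), is_proj f -> P A' (f ** pr1 b A1 A2)) ->
  (forall A' (f : hom b A2 A'), is_proj f -> P A' (f ** pr2 b A1 A2)) ->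
  (forall A1' A2' (f : hom b A1 A1') (g : hom b A2 A2'),
     is_proj f -> is_proj g -> P _ (par b f g)) -> P A' f.

Lemma proj_op_inv b A1 A2 A' (f : hom b (op b A1 A2) A') :
  is_proj f -> op_cases f.
Proof.
(* Only for a concrete [b] does [op b A1 A2] expose a constructor on which [Q] can match. *)
case: b f => f Pf.
  pose Q A A' : hom true A A' -> Prop :=
    if A is A1 /.\ A2 then @op_cases true A1 A2 A' else fun=> True.
  suff: Q _ _ f by [].
  by case: Pf => [//|||[] //] *; rewrite /Q => P P1 P2 P3; auto.
pose Q A A' : hom false A A' -> Prop :=
  if A is A1 \./ A2 then @op_cases false A1 A2 A' else fun=> True.
suff: Q _ _ f by [].
by case: Pf => [//|||[] //] *; rewrite /Q => P P1 P2 P3; auto.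
Qed.

Definition dop_cases b A1 A2 A' (f : hom b (op (~~ b) A1 A2) A') :=
  forall P : forall A', hom b (op (~~ b) A1 A2) A' -> Prop,
  (forall A1' A2' (f : hom b A1 A1') (g : hom b A2 A2'),
     is_proj f -> is_proj g -> P _ (par (~~ b) f g)) -> P A' f.

Lemma proj_dop_inv b A1 A2 A' (f : hom b (op (~~ b) A1 A2) A') :
  is_proj f -> dop_cases f.
Proof.
case: b f => f Pf.
  pose Q A A' : hom true A A' -> Prop :=
    if A is A1 \./ A2 then @dop_cases true A1 A2 A' else fun=> True.
  suff: Q _ _ f by [].
  by case: Pf => [//|||[] //] *; rewrite /Q //= => P; apply.
pose Q A A' : hom false A A' -> Prop :=
  if A is A1 /.\ A2 then @dop_cases false A1 A2 A' else fun=> True.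
suff: Q _ _ f by [].
by case: Pf => [//|||[] //] *; rewrite /Q //= => P; apply.
Qed.

(** * Relations and supports of polarized arrows *)

Definition hrel b A B : hom b A B -> finrel (G0 A) (G0 B) :=
  if b return hom b A B -> finrel (G0 A) (G0 B)
  then fun f => G f else fun f => rconv (G f).

(* The identity, made explicit because [G0 (op b A B)] is stuck for variable
   [b]. *)
Definition occ b A B : 'I_(G0 A + G0 B) -> 'I_(G0 (op b A B)) :=
  if b return 'I_(G0 A + G0 B) -> 'I_(G0 (op b A B)) then id else id.

Definition supp b A B (f : hom b A B) : pred 'I_(G0 A) :=
  fun i => [exists j, hrel f i j].

Definition disj b A B C (f : hom b A B) (g : hom b A C) :=
  forall i, supp f i -> supp g i -> False.

Lemma occ_inj b A B : injective (@occ b A B).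
Proof. by case: b. Qed.

Lemma occP b A B (i : 'I_(G0 (op b A B))) : exists k, i = occ b k.
Proof. by case: b i => i; exists i. Qed.

Lemma rel_heq b A B (f g : hom b A B) : f =h g -> hrel f =2 hrel g.
Proof.
by case: b f g => f g /G_eqL Efg i j //=; rewrite /rconv Efg.
Qed.

Lemma supp_heq b A B (f g : hom b A B) : f =h g -> supp f =1 supp g.
Proof. by move=> /rel_heq fg i; apply: eq_existsb => j. Qed.

Lemma rel_id b A : hrel (hid b A) =2 rid _.
Proof. by case: b => i j //=; rewrite /rconv /= /rid eq_sym. Qed.

Lemma rel_comp b A B C (g : hom b B C) (f : hom b A B) :
  hrel (g ** f) =2 rcomp (hrel g) (hrel f).
Proof.
by case: b g f => g f i j //=; apply: eq_existsb => k; rewrite /= andbC.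
Qed.

Lemma rel_pr1 b A B k j :
  hrel (pr1 b A B) (occ b k) j = (k == lshift (G0 B) j).
Proof. by case: b. Qed.

Lemma rel_pr2 b A B k j :
  hrel (pr2 b A B) (occ b k) j = (k == rshift (G0 A) j).
Proof. by case: b. Qed.

Lemma rel_par b c A1 A2 B1 B2 (f : hom b A1 B1) (g : hom b A2 B2) k l :
  hrel (par c f g) (occ c k) (occ c l) = rsum (hrel f) (hrel g) k l.
Proof.
by case: b c f g => [] [] f g //=; rewrite /rconv /rsum /=;
  case: split => ?; case: split => ?.
Qed.

Lemma rel_pairing b A B C (f : hom b C A) (g : hom b C B) i l :
  hrel (pairing f g) i (occ b l) =
  match split l with inl j => hrel f i j | inr j => hrel g i j end.
Proof.
case: b f g => f g; rewrite /hrel /= /rconv /rcomp /rdiag /rsum exists_split.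
  under eq_existsb do rewrite eq_lshift eq_lrshift orbF split_lshift.
  under [X in _ || X]eq_existsb do rewrite eq_rlshift eq_rshift split_rshift.
  by rewrite !exists_eql; case: split => j; rewrite ?orbF.
under eq_existsb do rewrite eq_lshift eq_lrshift orbF split_lshift.
under [X in _ || X]eq_existsb do rewrite eq_rlshift eq_rshift split_rshift.
by rewrite !exists_eqr; case: split => j; rewrite ?orbF.
Qed.

Lemma supp_comp b A B C (g : hom b B C) (f : hom b A B) i :
  (forall j, supp g j) -> supp f i -> supp (g ** f) i.
Proof.
move=> Sg /existsP[j fij]; have /existsP[k gjk] := Sg j.
apply/existsP; exists k; rewrite rel_comp; apply/existsP; exists j.
exact/andP.
Qed.

Lemma supp_comp_l b A B C (g : hom b B C) (f : hom b A B) i :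
  supp (g ** f) i -> supp f i.
Proof.
move=> /existsP[k]; rewrite rel_comp => /existsP[j /andP[fij _]].
by apply/existsP; exists j.
Qed.

Lemma rel_comp_pr1 b A1 A2 B (f : hom b A1 B) i j :
  hrel (f ** pr1 b A1 A2) (occ b (lshift _ i)) j = hrel f i j.
Proof.
rewrite rel_comp /rcomp.
under eq_existsb do rewrite rel_pr1 eq_lshift.
by rewrite exists_eql_sym.
Qed.

Lemma rel_comp_pr2 b A1 A2 B (f : hom b A2 B) i j :
  hrel (f ** pr2 b A1 A2) (occ b (rshift _ i)) j = hrel f i j.
Proof.
rewrite rel_comp /rcomp.
under eq_existsb do rewrite rel_pr2 eq_rshift.
by rewrite exists_eql_sym.
Qed.

Lemma supp_pr1 b A B C (f : hom b A C) k :
  supp (f ** pr1 b A B) (occ b k) =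
  if split k is inl i then supp f i else false.
Proof.
case: split_ordP => i ->.
  by apply: eq_existsb => j; rewrite rel_comp_pr1.
apply/existsP => -[j]; rewrite rel_comp => /existsP[l].
by rewrite rel_pr1 eq_rlshift.
Qed.

Lemma supp_pr2 b A B C (f : hom b B C) k :
  supp (f ** pr2 b A B) (occ b k) =
  if split k is inr i then supp f i else false.
Proof.
case: split_ordP => i ->.
  apply/existsP => -[j]; rewrite rel_comp => /existsP[l].
  by rewrite rel_pr2 eq_lrshift.
by apply: eq_existsb => j; rewrite rel_comp_pr2.
Qed.

Lemma supp_par b c A1 A2 B1 B2 (f : hom b A1 B1) (g : hom b A2 B2) k :
  supp (par c f g) (occ c k) =
  match split k with inl i => supp f i | inr i => supp g i end.
Proof.
apply/existsP/idP => [[l]|].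
  have [{}l ->] := occP l; rewrite rel_par /rsum.
  by case: split => i; case: split => j // fij; apply/existsP; exists j.
case: split_ordP => i -> /existsP[j fij].
  by exists (occ c (lshift _ j)); rewrite rel_par /rsum !split_lshift.
by exists (occ c (rshift _ j)); rewrite rel_par /rsum !split_rshift.
Qed.

Ltac case_proj H B f :=
  pattern B, f; match goal with |- ?P B f => apply: (H P) end.

Ltac by_disj D shift split_shift :=
  let i := fresh "i" in
  by move=> i ? ?; apply: (D (occ _ (shift _ _ i)));
     rewrite ?supp_pr1 ?supp_pr2 ?supp_par split_shift.

(** Induction on the source. At a letter both arrows are the identity, so their supports meet. At a
    product, a component reached by both arrows is treated by recursion, a component reached by only
    one is carried along, and [s] regroups by associativity and commutativity. At a coproduct both
    arrows act componentwise and [s] regroups by [esc_medial]. *)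
Lemma pair_proj b A B C (f : hom b A B) (g : hom b A C) :
    is_proj f -> is_proj g -> disj f g ->
  exists A' (r : hom b A A') (s : hom b A' (op b B C)),
    [/\ is_proj r, esc s & pairing f g =h s ** r].
Proof.
elim/(@op_ind b): A B C f g => [p|A1 A2 IH1 IH2|A1 A2 IH1 IH2] B C f g.
- move=> Pf Pg; case_proj (proj_letter_inv Pf) B f.
  case_proj (proj_letter_inv Pg) C g => D.
  have S : supp (hid b (Letter p)) (ord0 : 'I_1).
    by apply/existsP; exists ord0; rewrite rel_id; apply/eqP.
  by case: (D _ S S).
- move=> Pf Pg; case_proj (proj_op_inv Pf) B f =>
    [B' f1 Pf1|B' f2 Pf2|B1 B2 f1 f2 Pf1 Pf2];
    case_proj (proj_op_inv Pg) C g =>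
    [C' g1 Pg1|C' g2 Pg2|C1 C2 g1 g2 Pg1 Pg2] D.
  + have [|A' [r [s [Pr Ss E]]]] := IH1 _ _ f1 g1 Pf1 Pg1.
      by_disj D @lshift split_lshift.
    exists A', (r ** pr1 b A1 A2), s; split=> //; first by constructor.
    by rewrite -pairing_comp E hcompA.
  (* The two arrows read different components, so their pairing is already a discarding arrow. *)
  + exists (op b B' C'), (par b f1 g2), (hid b _).
    split; [by constructor | exact: esc_id | by hnorm].
  + have [|A' [r [s [Pr Ss E]]]] := IH1 _ _ f1 g1 Pf1 Pg1.
      by_disj D @lshift split_lshift.
    eexists _, (par b r g2), _; split; first by constructor.
      exact: (esc_comp (esc_assocl b _ _ _) (esc_par b Ss (esc_id b _))).
    rewrite hcompA -par_comp -E; by hnorm.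
  + exists (op b C' B'), (par b g1 f2), (pairing (pr2 b _ _) (pr1 b _ _)).
    split; [by constructor | exact: esc_swap | by hnorm].
  + have [|A' [r [s [Pr Ss E]]]] := IH2 _ _ f2 g2 Pf2 Pg2.
      by_disj D @rshift split_rshift.
    exists A', (r ** pr2 b A1 A2), s; split=> //; first by constructor.
    by rewrite -pairing_comp E hcompA.
  + have [|A' [r [s [Pr Ss E]]]] := IH2 _ _ f2 g2 Pf2 Pg2.
      by_disj D @rshift split_rshift.
    eexists _, (par b g1 r), _; split; first by constructor.
      exact: (esc_comp (esc_swap3 b _ _ _) (esc_par b (esc_id b _) Ss)).
    rewrite hcompA -par_comp -E; by hnorm.
  + have [|A' [r [s [Pr Ss E]]]] := IH1 _ _ f1 g1 Pf1 Pg1.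
      by_disj D @lshift split_lshift.
    eexists _, (par b r f2), _; split; first by constructor.
      (* The recursion leaves the factors in the order [B1], [C'], [B2], so [C'] and [B2] have to be
         exchanged. *)
      apply: (esc_comp (esc_comp _ (esc_assocl b B1 C' B2))
                       (esc_par b Ss (esc_id b _))).
      exact: (esc_comp (esc_assocr b _ _ _)
                       (esc_par b (esc_id b _) (esc_swap b _ _))).
    rewrite hcompA -par_comp -E; by hnorm.
  + have [|A' [r [s [Pr Ss E]]]] := IH2 _ _ f2 g2 Pf2 Pg2.
      by_disj D @rshift split_rshift.
    eexists _, (par b f1 r), _; split; first by constructor.
      exact: (esc_comp (esc_assocr b _ _ _) (esc_par b (esc_id b _) Ss)).
    rewrite hcompA -par_comp -E; by hnorm.
  + have [|A1' [r1 [s1 [Pr1 Ss1 E1]]]] := IH1 _ _ f1 g1 Pf1 Pg1.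
      by_disj D @lshift split_lshift.
    have [|A2' [r2 [s2 [Pr2 Ss2 E2]]]] := IH2 _ _ f2 g2 Pf2 Pg2.
      by_disj D @rshift split_rshift.
    eexists _, (par b r1 r2), _; split; first by constructor.
      exact: (esc_comp (esc_mid b _ _ _ _) (esc_par b Ss1 Ss2)).
    rewrite hcompA -par_comp -E1 -E2; by hnorm.
- move=> Pf Pg; case_proj (proj_dop_inv Pf) B f => B1 B2 f1 f2 Pf1 Pf2.
  case_proj (proj_dop_inv Pg) C g => C1 C2 g1 g2 Pg1 Pg2 D.
  have [|A1' [r1 [s1 [Pr1 Ss1 E1]]]] := IH1 _ _ f1 g1 Pf1 Pg1.
    by_disj D @lshift split_lshift.
  have [|A2' [r2 [s2 [Pr2 Ss2 E2]]]] := IH2 _ _ f2 g2 Pf2 Pg2.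
    by_disj D @rshift split_rshift.
  eexists _, (par (~~ b) r1 r2), _; split; first by constructor.
    exact: (esc_comp (esc_medial b _ _ _ _) (esc_par (~~ b) Ss1 Ss2)).
  rewrite hcompA -par_comp -E1 -E2 pairing_comp -!par_comp.
  by rewrite !pr1_pairing !pr2_pairing.
Qed.

(** * Cut elimination *)

(** [cf_eq] makes this a property of arrows of the free category instead of terms. There is no
    constructor for general composition, and identities are taken at letters only. *)
Inductive cut_free : forall A B, term A B -> Prop :=
| cf_eq A B (f g : term A B) : eqL f g -> cut_free f -> cut_free g
| cf_letter p : cut_free (Id (Letter p))
| cf_hk1 A1 A2 B (f : term A1 B) : cut_free f -> cut_free (Comp f (hk1 A1 A2))
| cf_hk2 A1 A2 B (f : term A2 B) : cut_free f -> cut_free (Comp f (hk2 A1 A2))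
| cf_vk1 A B1 B2 (f : term A B1) : cut_free f -> cut_free (Comp (vk1 B1 B2) f)
| cf_vk2 A B1 B2 (f : term A B2) : cut_free f -> cut_free (Comp (vk2 B1 B2) f)
| cf_pair A B C (f : term C A) (g : term C B) :
    cut_free f -> cut_free g -> cut_free (pairing (b := true) f g)
| cf_copair A B C (f : term A C) (g : term B C) :
    cut_free f -> cut_free g -> cut_free (pairing (b := false) f g).

(* Cut elimination runs by structural induction: on [f] first, turning it into
   a [cuttable] arrow, then on the [g] it is composed with. *)
Definition cuttable A B (f : term A B) :=
  forall C (g : term B C), cut_free g -> cut_free (Comp g f).

(** Arrows whose last step introduces the main connective of the target. Requiring [cuttable]
    components records the induction hypothesis on [f]. *)
Definition right_intro A B : term A B -> Prop :=
  match B with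
  | Letter _ => fun=> False
  | B1 /.\ B2 => fun f => exists (f1 : term A B1) (f2 : term A B2),
      [/\ cuttable f1, cuttable f2 & eqL f (pairing (b := true) f1 f2)]
  | B1 \./ B2 => fun f =>
      (exists2 f1 : term A B1, cuttable f1 & eqL f (Comp (vk1 B1 B2) f1)) \/
      (exists2 f2 : term A B2, cuttable f2 & eqL f (Comp (vk2 B1 B2) f2))
  end.

(** Induction on [g]. If [g] eliminates the connective that [f] introduces, the cut reduces to one
    with a component of [f], which is cuttable; otherwise the composition moves above the last step
    of [g]. *)
Lemma right_intro_cut A B C (f : term A B) (g : term B C) :
  right_intro f -> cut_free g -> cut_free (Comp g f).
Proof.
move=> If cf_g; elim: cf_g A f If => {B C g}.
- move=> B C f g fg _ IH A h /IH; apply: cf_eq.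
  by apply: eqL_Comp.
- by [].
- move=> B1 B2 C g cg _ A f [f1 [f2 [C1 _ Ef]]].
  apply: (cf_eq _ (C1 _ g cg)); rewrite Ef -eqL_assoc.
  by apply: eqL_Comp => //; symmetry; exact: (pr1_pairing (b := true)).
- move=> B1 B2 C g cg _ A f [f1 [f2 [_ C2 Ef]]].
  apply: (cf_eq _ (C2 _ g cg)); rewrite Ef -eqL_assoc.
  by apply: eqL_Comp => //; symmetry; exact: (pr2_pairing (b := true)).
- move=> B C1 C2 g _ IH A f /IH/(cf_vk1 C2); apply: cf_eq.
  exact: eqL_assoc.
- move=> B C1 C2 g _ IH A f /IH/(cf_vk2 C1); apply: cf_eq.
  exact: eqL_assoc.
- move=> C1 C2 B g1 g2 _ IH1 _ IH2 A f If.
  apply: cf_eq (cf_pair (IH1 _ _ If) (IH2 _ _ If)).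
  symmetry; exact: (pairing_comp (b := true)).
- move=> B1 B2 C g1 g2 c1 _ c2 _ A f [[f1 C1 Ef]|[f2 C2 Ef]].
    apply: (cf_eq _ (C1 _ g1 c1)); rewrite Ef eqL_assoc.
    apply: eqL_Comp => //; symmetry; exact: (pr1_pairing (b := false)).
  apply: (cf_eq _ (C2 _ g2 c2)); rewrite Ef eqL_assoc.
  apply: eqL_Comp => //; symmetry; exact: (pr2_pairing (b := false)).
Qed.

(** Steps of [f] acting on its source commute with postcomposition. Steps introducing the target
    connective fall under [right_intro_cut], their components being cuttable by induction. *)
Lemma cf_comp A B C (f : term A B) (g : term B C) :
  cut_free f -> cut_free g -> cut_free (Comp g f).
Proof.
move=> cf_f; elim: cf_f C g => {A B f}.
- move=> A B f f' ff' _ IH C g /IH; apply: cf_eq; exact: eqL_Comp.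
- by move=> p C g; apply: cf_eq; symmetry; apply: eqL_idr.
- move=> A1 A2 B f _ IH C g /IH/(cf_hk1 A2); apply: cf_eq.
  by symmetry; apply: eqL_assoc.
- move=> A1 A2 B f _ IH C g /IH/(cf_hk2 A1); apply: cf_eq.
  by symmetry; apply: eqL_assoc.
- move=> A B1 B2 f _ IH C g; apply: right_intro_cut.
  by left; exists f.
- move=> A B1 B2 f _ IH C g; apply: right_intro_cut.
  by right; exists f.
- move=> A B D f1 f2 _ IH1 _ IH2 C g; apply: right_intro_cut.
  by exists f1, f2.
- move=> A B D f1 f2 _ IH1 _ IH2 C g cg.
  apply: cf_eq (cf_copair (IH1 _ _ cg) (IH2 _ _ cg)).
  symmetry; exact: (pairing_comp (b := false)).
Qed.

Lemma cf_hk_id1 A B : cut_free (Id A) -> cut_free (hk1 A B).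
Proof. by move=> /(cf_hk1 B); apply: cf_eq; apply: eqL_idl. Qed.

Lemma cf_hk_id2 A B : cut_free (Id B) -> cut_free (hk2 A B).
Proof. by move=> /(cf_hk2 A); apply: cf_eq; apply: eqL_idl. Qed.

Lemma cf_vk_id1 A B : cut_free (Id A) -> cut_free (vk1 A B).
Proof. by move=> /(cf_vk1 B); apply: cf_eq; apply: eqL_idr. Qed.

Lemma cf_vk_id2 A B : cut_free (Id B) -> cut_free (vk2 A B).
Proof. by move=> /(cf_vk2 A); apply: cf_eq; apply: eqL_idr. Qed.

Lemma cf_id A : cut_free (Id A).
Proof.
elim: A => [p|A1 cA1 A2 cA2|A1 cA1 A2 cA2]; first exact: cf_letter.
  apply: cf_eq (cf_pair (cf_hk_id1 _ cA1) (cf_hk_id2 _ cA2)).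
  exact: (pairing_pr true).
apply: cf_eq (cf_copair (cf_vk_id1 _ cA1) (cf_vk_id2 _ cA2)).
exact: (pairing_pr false).
Qed.

Lemma cf_hw A : cut_free (hw A).
Proof.
apply: cf_eq (cf_pair (cf_id A) (cf_id A)).
by rewrite /= eqL_And1 eqL_idl.
Qed.

Lemma cf_vw A : cut_free (vw A).
Proof.
apply: cf_eq (cf_copair (cf_id A) (cf_id A)).
by rewrite /= eqL_Or1 eqL_idr.
Qed.

Lemma cf_And A1 A2 B1 B2 (f : term A1 B1) (g : term A2 B2) :
  cut_free f -> cut_free g -> cut_free (AndT f g).
Proof.
move=> cf_f cg; apply: cf_eq (cf_pair (cf_hk1 A2 cf_f) (cf_hk2 A1 cg)).
symmetry; exact: (par_pairing (b := true)).
Qed.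

Lemma cf_Or A1 A2 B1 B2 (f : term A1 B1) (g : term A2 B2) :
  cut_free f -> cut_free g -> cut_free (OrT f g).
Proof.
move=> cf_f cg; apply: cf_eq (cf_copair (cf_vk1 B2 cf_f) (cf_vk2 B1 cg)).
symmetry; exact: (par_pairing (b := false)).
Qed.

Lemma cut_elimination A B (f : term A B) : cut_free f.
Proof.
(* The structural arrows are replaced by the right-hand sides of their defining equations. *)
elim: f => {A B} *; try match goal with
  | |- cut_free (hbr _ _ _) => apply: cf_eq (eqL_sym (eqL_hbr _ _ _)) _
  | |- cut_free (hbl _ _ _) => apply: cf_eq (eqL_sym (eqL_hbl _ _ _)) _
  | |- cut_free (hc _ _) => apply: cf_eq (eqL_sym (eqL_hc _ _)) _
  | |- cut_free (vbr _ _ _) => apply: cf_eq (eqL_sym (eqL_vbr _ _ _)) _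
  | |- cut_free (vbl _ _ _) => apply: cf_eq (eqL_sym (eqL_vbl _ _ _)) _
  | |- cut_free (vc _ _) => apply: cf_eq (eqL_sym (eqL_vc _ _)) _
  | |- cut_free (ck _ _ _ _) => apply: cf_eq (eqL_sym (eqL_ck _ _ _ _)) _
  end;
  by repeat first [exact: cf_id | exact: cf_hw | exact: cf_vw
    | apply: cf_hk_id1 | apply: cf_hk_id2 | apply: cf_vk_id1 | apply: cf_vk_id2
    | apply: cf_comp | apply: cf_And | apply: cf_Or].
Qed.

(** * Factorization of partial injections *)

(* [f : hom b A B] is a projection of [B] onto [A] in the opposite category. *)
Definition coproj b A B : hom b A B -> Prop :=
  if b return hom b A B -> Prop then @is_proj false B A else @is_proj true B A.

Definition htotal b A B (f : hom b A B) := forall i, supp f i.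

Definition row_inj b A B (f : hom b A B) :=
  forall i j k, hrel f i j -> hrel f i k -> j = k.

Definition col_inj b A B (f : hom b A B) :=
  forall i j k, hrel f i k -> hrel f j k -> i = j.

(** There are no units: a discarded conjunct always contains a letter, so [G] detects the loss. *)
Lemma G0_gt0 A : 0 < G0 A.
Proof. by elim: A => //= A IHA B _; rewrite addn_gt0 IHA. Qed.

(** * Totality and surjectivity of the relations of arrows *)

Definition cototal b A B (f : hom b A B) := forall j, exists i, hrel f i j.

Lemma cototal_id b A : cototal (hid b A).
Proof. by move=> j; exists j; rewrite rel_id; apply/eqP. Qed.

Lemma cototal_comp b A B C (g : hom b B C) (f : hom b A B) :
  cototal g -> cototal f -> cototal (g ** f).
Proof.
move=> Cg Cf k; have [j gjk] := Cg k; have [i fij] := Cf j.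
by exists i; rewrite rel_comp; apply/existsP; exists j; rewrite fij.
Qed.

Lemma cototal_pr1 b A B : cototal (pr1 b A B).
Proof. by move=> j; exists (occ b (lshift _ j)); rewrite rel_pr1. Qed.

Lemma cototal_pr2 b A B : cototal (pr2 b A B).
Proof. by move=> j; exists (occ b (rshift _ j)); rewrite rel_pr2. Qed.

Lemma cototal_par b c A1 A2 B1 B2 (f : hom b A1 B1) (g : hom b A2 B2) :
  cototal f -> cototal g -> cototal (par c f g).
Proof.
move=> Cf Cg j; have [l ->] := occP j; case: (split_ordP l) => k ->.
  have [i fik] := Cf k.
  by exists (occ c (lshift _ i)); rewrite rel_par /rsum !split_lshift.
have [i gik] := Cg k.
by exists (occ c (rshift _ i)); rewrite rel_par /rsum !split_rshift.
Qed.

Lemma cototal_pairing b A B C (f : hom b C A) (g : hom b C B) :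
  cototal f -> cototal g -> cototal (pairing f g).
Proof.
move=> Cf Cg j; have [l ->] := occP j; case: (split_ordP l) => k ->.
  by have [i fik] := Cf k; exists i; rewrite rel_pairing split_lshift.
by have [i gik] := Cg k; exists i; rewrite rel_pairing split_rshift.
Qed.

Lemma total_par b c A1 A2 B1 B2 (f : hom b A1 B1) (g : hom b A2 B2) :
  htotal f -> htotal g -> htotal (par c f g).
Proof.
by move=> Tf Tg i; have [k ->] := occP i; rewrite supp_par; case: split.
Qed.

Lemma supp_pairing b A B C (f : hom b C A) (g : hom b C B) i :
  supp f i || supp g i -> supp (pairing f g) i.
Proof.
case/orP=> /existsP[j]; rewrite /supp => fij; apply/existsP.
  by exists (occ b (lshift _ j)); rewrite rel_pairing split_lshift.
by exists (occ b (rshift _ j)); rewrite rel_pairing split_rshift.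
Qed.

(** Invariant under converse, hence under change of polarity, so that one verification covers an
    arrow and its dual. *)
Definition bitotal b A B (f : hom b A B) := htotal f /\ cototal f.

Lemma bitotal_heq b A B (f g : hom b A B) : f =h g -> bitotal g -> bitotal f.
Proof.
move=> fg [Tg Cg]; split=> i; first by rewrite (supp_heq fg).
by have [j gji] := Cg i; exists j; rewrite (rel_heq fg).
Qed.

Lemma bitotal_flip A B (f : term A B) :
  bitotal (b := false) f -> bitotal (b := true) f.
Proof.
move=> [Tf Cf]; split=> i; first by apply/existsP; exact: Cf.
by apply/existsP; exact: Tf.
Qed.

Lemma bitotal_comp b A B C (g : hom b B C) (f : hom b A B) :
  bitotal g -> bitotal f -> bitotal (g ** f).
Proof.
move=> [Tg Cg] [Tf Cf]; split; last exact: cototal_comp.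
by move=> i; apply: supp_comp.
Qed.

Lemma bitotal_par b c A1 A2 B1 B2 (f : hom b A1 B1) (g : hom b A2 B2) :
  bitotal f -> bitotal g -> bitotal (par c f g).
Proof.
by move=> [Tf Cf] [Tg Cg]; split; [apply: total_par | apply: cototal_par].
Qed.

Lemma bitotal_id b A : bitotal (hid b A).
Proof.
split; last exact: cototal_id.
by move=> i; apply/existsP; exists i; rewrite rel_id; apply/eqP.
Qed.

Lemma supp_pr1_id b A B k :
  supp (pr1 b A B) (occ b k) = if split k is inl _ then true else false.
Proof.
apply/existsP/idP => [[j]|].
  by rewrite rel_pr1 => /eqP->; rewrite split_lshift.
by case: split_ordP => j -> // _; exists j; rewrite rel_pr1.
Qed.

Lemma supp_pr2_id b A B k :
  supp (pr2 b A B) (occ b k) = if split k is inr _ then true else false.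
Proof.
apply/existsP/idP => [[j]|].
  by rewrite rel_pr2 => /eqP->; rewrite split_rshift.
by case: split_ordP => j -> // _; exists j; rewrite rel_pr2.
Qed.

Ltac cototal_tac := repeat first
  [ exact: cototal_id | exact: cototal_pr1 | exact: cototal_pr2
  | apply: cototal_comp | apply: cototal_par | apply: cototal_pairing].

Lemma bitotal_swap b A B : bitotal (pairing (pr2 b A B) (pr1 b A B)).
Proof.
split; last by cototal_tac.
move=> i; apply: supp_pairing; have [k ->] := occP i.
by rewrite supp_pr1_id supp_pr2_id; case: split.
Qed.

Lemma bitotal_assocr b A B C :
  bitotal (pairing (par b (hid b A) (pr1 b B C))
                   (pr2 b B C ** pr2 b A (op b B C))).
Proof.
split; last by cototal_tac.
move=> i; apply: supp_pairing; have [k ->] := occP i.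
rewrite supp_par supp_pr2; case: split => {k} j.
  by rewrite (bitotal_id b A).1.
by have [k ->] := occP j; rewrite supp_pr1_id supp_pr2_id; case: split.
Qed.

Lemma bitotal_assocl b A B C :
  bitotal (pairing (pr1 b A B ** pr1 b (op b A B) C)
                   (par b (pr2 b A B) (hid b C))).
Proof.
split; last by cototal_tac.
move=> i; apply: supp_pairing; have [k ->] := occP i.
rewrite supp_par supp_pr1; case: split => {k} j; last first.
  by rewrite (bitotal_id b C).1.
by have [k ->] := occP j; rewrite supp_pr1_id supp_pr2_id; case: split.
Qed.

Lemma bitotal_medial b A B C D :
  bitotal (pairing (par (~~ b) (pr1 b A B) (pr1 b C D))
               (par (~~ b) (pr2 b A B) (pr2 b C D))).
Proof.
split; last by cototal_tac.
move=> i; apply: supp_pairing; have [k ->] := occP i.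
by rewrite !supp_par; case: split => {k} j; have [k ->] := occP j;
  rewrite supp_pr1_id supp_pr2_id; case: split.
Qed.

Lemma SCk_bitotal A B (f : term A B) : is_SCk f -> bitotal (b := true) f.
Proof.
elim=> {A B f} *.
- exact: (bitotal_id true).
- exact: (@bitotal_comp true).
- exact: (@bitotal_par true true).
- exact: (@bitotal_par true false).
- apply: bitotal_heq (bitotal_assocr _ _ _ _); exact: eqL_hbr.
- apply: bitotal_heq (bitotal_assocl _ _ _ _); exact: eqL_hbl.
- apply: bitotal_heq (bitotal_swap _ _ _); exact: eqL_hc.
- apply: bitotal_flip; apply: bitotal_heq (bitotal_assocl _ _ _ _).
  exact: eqL_vbr.
- apply: bitotal_flip; apply: bitotal_heq (bitotal_assocr _ _ _ _).
  exact: eqL_vbl.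
- apply: bitotal_flip; apply: bitotal_heq (bitotal_swap _ _ _).
  exact: eqL_vc.
- apply: bitotal_heq (bitotal_medial _ _ _ _ _); exact: eqL_ck.
Qed.

Lemma esc_total b A B (f : hom b A B) : esc f -> htotal f.
Proof.
move=> [g Sg fg]; apply: proj1 (bitotal_heq fg _).
case: b g f Sg {fg} => g f /SCk_bitotal // [Tg Cg].
by split=> i; [apply/existsP; exact: Cg | apply/existsP; exact: Tg].
Qed.

Lemma proj_cototal b A B (f : hom b A B) : is_proj f -> cototal f.
Proof.
elim=> {A B f}.
- by move=> p; apply: cototal_id.
- by move=> A1 A2 A' f _ IH; apply: cototal_comp (@cototal_pr1 _ _ _).
- by move=> A1 A2 A' f _ IH; apply: cototal_comp (@cototal_pr2 _ _ _).
- by move=> c A1 A2 A1' A2' f g _ IHf _ IHg; apply: cototal_par.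
Qed.

Lemma coproj_total b A B (f : hom b A B) : coproj f -> htotal f.
Proof.
case: b f => f Pf i; have [j fji] := proj_cototal Pf i;
  by apply/existsP; exists j.
Qed.

(** A use of [pr1] or [pr2] would discard a letter and break totality; what remains is built by
    [par] from identities of letters, hence lies in SC^k. *)
Lemma proj_total_SCk b A B (f : hom b A B) : is_proj f -> htotal f -> hSCk f.
Proof.
elim=> {A B f}.
- by move=> p _; case: (b); apply: SCk_Id.
(* The occurrence chosen is the first one in the discarded [A2]. *)
- move=> A1 A2 A' f _ _ /(_ (occ b (rshift _ (Ordinal (G0_gt0 A2))))).
  by rewrite supp_pr1 split_rshift.
- move=> A1 A2 A' f _ _ /(_ (occ b (lshift _ (Ordinal (G0_gt0 A1))))).
  by rewrite supp_pr2 split_lshift.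
- move=> c A1 A2 A1' A2' f g _ IHf _ IHg T.
  have Sf : hSCk f.
    apply: IHf => i; have := T (occ c (lshift _ i)).
    by rewrite supp_par split_lshift.
  have Sg : hSCk g.
    apply: IHg => i; have := T (occ c (rshift _ i)).
    by rewrite supp_par split_rshift.
  by case: (b) (c) f g Sf Sg {IHf IHg T} => [] [] f g Sf Sg /=;
    (apply: SCk_And || apply: SCk_Or).
Qed.

(** * Factorizations through SC^k *)

Definition factored b A B (f : hom b A B) :=
  exists A' B' (p : hom b A A') (s : hom b A' B') (q : hom b B' B),
    [/\ is_proj p, esc s, coproj q & f =h q ** s ** p].

(** In the opposite category the outer factors [p] and [q] exchange roles. *)
Lemma factored_flip A B (f : term A B) :
  factored (b := true) f <-> factored (b := false) f.
Proof.
split=> -[A' [B' [p [s [q [Pp [s' Ss ss'] Pq Ef]]]]]];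
  exists B', A', q, s, p; split=> //; try (by exists s');
  (etransitivity; first exact: Ef);
  [|symmetry]; exact: eqL_assoc.
Qed.

Lemma factored_pr1 b A1 A2 B (f : hom b A1 B) :
  factored f -> factored (f ** pr1 b A1 A2).
Proof.
move=> [A' [B' [p [s [q [Pp Ss Pq Ef]]]]]].
exists A', B', (p ** pr1 b A1 A2), s, q; split=> //; first by constructor.
by rewrite Ef !hcompA.
Qed.

Lemma factored_pr2 b A1 A2 B (f : hom b A2 B) :
  factored f -> factored (f ** pr2 b A1 A2).
Proof.
move=> [A' [B' [p [s [q [Pp Ss Pq Ef]]]]]].
exists A', B', (p ** pr2 b A1 A2), s, q; split=> //; first by constructor.
by rewrite Ef !hcompA.
Qed.

(** The pairing equals the pairing of [p1] and [p2], followed by [par b s1 s2] and then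
    [par b q1 q2]; [pair_proj] applies to its first factor. *)
Lemma factored_pairing b A B C (f : hom b C A) (g : hom b C B) :
  factored f -> factored g -> disj f g -> factored (pairing f g).
Proof.
move=> [A1 [B1 [p1 [s1 [q1 [Pp1 Ss1 Pq1 E1]]]]]].
move=> [A2 [B2 [p2 [s2 [q2 [Pp2 Ss2 Pq2 E2]]]]]] D.
have [|A' [r [s [Pr Ss Er]]]] := pair_proj Pp1 Pp2.
  (* As [t] and [q] are total, every occurrence kept by [p] is in the support of [h]; thus
     disjointness passes from [f], [g] to [p1], [p2]. *)
  have supp_p A' B' Z (h : hom b C Z) (p : hom b C A') t (q : hom b B' Z) i :
      esc t -> coproj q -> h =h q ** t ** p -> supp p i -> supp h i.
    move=> St Pq Eh pi; rewrite (supp_heq Eh).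
    by apply: supp_comp (coproj_total Pq) (supp_comp (esc_total St) pi).
  by move=> i p1i p2i; apply: (D i); [apply: supp_p E1 _ | apply: supp_p E2 _].
exists A', (op b B1 B2), r, (par b s1 s2 ** s), (par b q1 q2); split=> //.
- exact: (esc_comp (esc_par b Ss1 Ss2) Ss).
- by case: (b) (q1) (q2) Pq1 Pq2 => u v Pu Pv; exact: proj_par.
- rewrite hcompA -Er E1 E2; by hnorm.
Qed.

(** An occurrence in both supports would be related to an occurrence in each component of the
    target, contradicting single-valuedness; hence [disj]. *)
Lemma row_inj_pairing b A B C (f : hom b C A) (g : hom b C B) :
  row_inj (pairing f g) -> [/\ row_inj f, row_inj g & disj f g].
Proof.
move=> I; split.
- move=> i j k fij fik; apply/(@lshift_inj _ (G0 B))/(@occ_inj b).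
  by apply: (I i); rewrite rel_pairing split_lshift.
- move=> i j k fij fik; apply/(@rshift_inj (G0 A))/(@occ_inj b).
  by apply: (I i); rewrite rel_pairing split_rshift.
- move=> i /existsP[j fij] /existsP[k gik].
  have /occ_inj/eqP : occ b (lshift (G0 B) j) = occ b (rshift (G0 A) k).
    by apply: (I i); rewrite rel_pairing ?split_lshift ?split_rshift.
  by rewrite eq_lrshift.
Qed.

Lemma col_inj_pairing b A B C (f : hom b C A) (g : hom b C B) :
  col_inj (pairing f g) -> col_inj f /\ col_inj g.
Proof.
move=> I; split=> i j k ik jk.
  by apply: (I _ _ (occ b (lshift _ k))); rewrite rel_pairing split_lshift.
by apply: (I _ _ (occ b (rshift _ k))); rewrite rel_pairing split_rshift.
Qed.

(** Partial injections: unlike bijectivity, this property passes to the components of a pairing, and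
    it is self-dual. *)
Definition binj b A B (f : hom b A B) := row_inj f /\ col_inj f.

Lemma binj_pr1 b A1 A2 B (f : hom b A1 B) : binj (f ** pr1 b A1 A2) -> binj f.
Proof.
move=> [R C]; split=> i j k ij ik.
  by apply: (R (occ b (lshift _ i))); rewrite rel_comp_pr1.
apply/(@lshift_inj _ (G0 A2))/(@occ_inj b).
by apply: (C _ _ k); rewrite rel_comp_pr1.
Qed.

Lemma binj_pr2 b A1 A2 B (f : hom b A2 B) : binj (f ** pr2 b A1 A2) -> binj f.
Proof.
move=> [R C]; split=> i j k ij ik.
  by apply: (R (occ b (rshift _ i))); rewrite rel_comp_pr2.
apply/(@rshift_inj (G0 A1))/(@occ_inj b).
by apply: (C _ _ k); rewrite rel_comp_pr2.
Qed.

Lemma binj_flip A B (f : term A B) :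
  binj (b := true) f <-> binj (b := false) f.
Proof. by split=> -[R C]; split=> i j k; (apply: C || apply: R). Qed.

(** Injections and copairings are the projections and pairings of the opposite category, so their
    cases follow at the other polarity through the flip lemmas. *)
Lemma cut_free_factored A B (f : term A B) :
  cut_free f -> binj (b := true) f -> factored (b := true) f.
Proof.
elim=> {A B f}.
- move=> A B f g fg _ IH [R C].
  case: IH => [|A' [B' [p [s [q [Pp Ss Pq Ef]]]]]].
    by split=> i j k; rewrite !(rel_heq (b := true) fg); [apply: R | apply: C].
  exists A', B', p, s, q; split=> //.
  by etransitivity; [symmetry; exact: fg | exact: Ef].
- move=> p _; exists (Letter p), (Letter p).
  exists (hid true _), (hid true _), (hid true _).
  split; [exact: proj_letter | exact: esc_id | exact: (proj_letter false) |].
  by rewrite !hcomp1l.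
- move=> A1 A2 B f _ IH I; apply: (@factored_pr1 true); apply: IH.
  exact: (@binj_pr1 true) I.
- move=> A1 A2 B f _ IH I; apply: (@factored_pr2 true); apply: IH.
  exact: (@binj_pr2 true) I.
- move=> A B1 B2 f _ IH I; apply/factored_flip.
  apply: (@factored_pr1 false); apply/factored_flip/IH/binj_flip.
  by move/binj_flip: I; apply: (@binj_pr1 false).
- move=> A B1 B2 f _ IH I; apply/factored_flip.
  apply: (@factored_pr2 false); apply/factored_flip/IH/binj_flip.
  by move/binj_flip: I; apply: (@binj_pr2 false).
- move=> A B C f g _ IHf _ IHg.
  move=> [/row_inj_pairing[Rf Rg D] /col_inj_pairing[Cf Cg]].
  by apply: factored_pairing D; [apply: IHf | apply: IHg].
- move=> A B C f g _ IHf _ IHg /binj_flip.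
  move=> [/row_inj_pairing[Rf Rg D] /col_inj_pairing[Cf Cg]].
  apply/factored_flip; apply: factored_pairing D; apply/factored_flip.
    by apply/IHf/binj_flip.
  by apply/IHg/binj_flip.
Qed.

End Polarity.

Theorem mainTheorem6 (X : Type) (A B : formula X) (f : term A B)
    (Gf_bij : is_bijection (G f)) :
  exists f' : term A B, is_SCk f' /\ f =L f'.
Proof.
have [h [h' hK h'K] Gh] := Gf_bij.
have [|A' [B' [p [s [q [Pp [s' Ss ss'] Pq Ef]]]]]] :=
  cut_free_factored (cut_elimination f).
  split=> i j k /=; rewrite !Gh; first by move=> /eqP-> /eqP->.
  by move=> /eqP-> /eqP /(can_inj hK).
exists (Comp q (Comp s' p)); split; last first.
  by etransitivity; [exact: Ef | apply: eqL_Comp => //; exact: eqL_Comp].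
apply: SCk_Comp; last apply: (SCk_Comp Ss).
  (* Each [j] is reached from [h' j] through [q], so [q], read in the opposite category, discards
     nothing. *)
  apply: (proj_total_SCk (b := false) Pq) => j.
  apply: (supp_comp_l (b := false) (g := Comp s p)).
  apply/existsP; exists (h' j).
  rewrite -(rel_heq (b := false) Ef).
  by rewrite /hrel /rconv Gh h'K.
(* Each [i] is related to [h i] through [p], so [p] discards nothing. *)
apply: (proj_total_SCk (b := true) Pp) => i.
apply: (supp_comp_l (b := true) (g := Comp q s)).
apply/existsP; exists (h i).
rewrite -(rel_heq (b := true) (f := f)) /=; first by rewrite Gh.
by etransitivity; [exact: Ef | exact: eqL_assoc].
Qed.
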